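(* Let $(T,X)$ be an invertible semiflow on a compact Hausdorff space $X$ with $T$ an amenable semigroup, and let $x\in X$. Then: (1) $x$ is a distal point of $(T,X)$ if and only if $x$ is a distal point of $(\langle T\rangle,X)$. (2) $(T,X)$ is point-distal if and only if $(\langle T\rangle,X)$ is a point-distal flow. (3) The reflection $(X,T)$ is point-distal if and only if $(\langle T\rangle,X)$ is a point-distal flow.
   Context: $X$ is a nonempty compact Hausdorff space and $T$ is a discrete infinite semigroup with identity $e$. A semiflow $(T,X)$ is a continuous map $T\times X\to X$, $(t,x)\mapsto tx$, with $ex=x$ and $t(sx)=(ts)x$. It is invertible if for every $t\in T$ the map $x\mapsto tx$ is a bijection (hence a homeomorphism) of $X$; then $\langle T\rangle$ is the group of self-homeomorphisms of $X$ generated by $T$, acting on $X$ (a flow), and the reflection $(X,T)$ is the right action $(x,t)\mapsto xt:=t^{-1}x$. A discrete semigroup $T$ is amenable if every semiflow $(T,Y)$ with phase semigroup $T$ on a nonempty compact Hausdorff space $Y$ admits an invariant Borel probability measure, i.e. a Borel probability measure $\mu$ on $Y$ with $\mu(B)=\mu(t^{-1}B)$ for all $t\in T$ and all Borel sets $B\subseteq Y$, where $t^{-1}B=\{y\in Y: ty\in B\}$. Points $x,y$ are proximal under $(T,X)$ if there are a net $(t_n)$ in $T$ and $z\in X$ with $t_nx\to z$, $t_ny\to z$. $x$ is a distal point of $(T,X)$ if no point of $\overline{Tx}$ other than $x$ is proximal to $x$, where $Tx=\{tx:t\in T\}$. $(T,X)$ is point-distal if it has a distal point $x$ with $Tx$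 dense in $X$. The same notions for $(\langle T\rangle,X)$ use elements of $\langle T\rangle$, and for $(X,T)$ use the maps $x\mapsto t^{-1}x$, $t\in T$. *)

(* Defs.v *)
From HB Require Import structures.
From mathcomp Require Import all_boot all_order all_algebra.
From mathcomp Require Import all_classical all_reals all_analysis.

Set Implicit Arguments.
Unset Strict Implicit.
Unset Printing Implicit Defensive.

Local Open Scope classical_set_scope.

Definition semiflow (T : monoidType) (X : topologicalType)
    (act : T -> X -> X) : Prop :=
  [/\ continuous (fun p : discrete_topology T * X => act p.1 p.2),
      (forall x, act 1%g x = x) &
      forall t s x, act t (act s x) = act (t * s)%g x].

Definition invertible_semiflow (T : monoidType) (X : topologicalType)
    (act : T -> X -> X) : Prop :=
  semiflow act /\ forall t, bijective (act t).

(* The base point of Y only records that Y is nonempty; the library's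
   generated sigma-algebras are defined on pointed types. *)
Definition amenable (R : realType) (T : monoidType) : Prop :=
  forall (Y : ptopologicalType) (act : T -> Y -> Y),
    compact [set: Y] -> hausdorff_space Y -> semiflow act ->
    exists mu : probability (g_sigma_algebraType (@open Y)) R,
      forall (t : T) (B : set Y),
        (@open Y).-sigma.-measurable B -> mu B = mu (act t @^-1` B).

Definition directed (D : Type) (le : D -> D -> Prop) : Prop :=
  [/\ inhabited D,
      (forall a, le a a),
      (forall a b c, le a b -> le b c -> le a c) &
      forall a b, exists c, le a c /\ le b c].

(* A net u indexed by (D, le) converges to z when u @ net_filter le --> z. *)
Definition net_filter (D : Type) (le : D -> D -> Prop) : set_system D :=
  filter_from [set: D] (fun a => [set b | le a b]).

(* The notions below concern an arbitrary family act of self-maps of X,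
   so that they apply to T, to the group it generates, and to the reflection. *)

Definition orbit (S : Type) (X : topologicalType) (act : S -> X -> X)
    (x : X) : set X :=
  [set act s x | s in [set: S]].

Definition proximal (S : Type) (X : topologicalType) (act : S -> X -> X)
    (x y : X) : Prop :=
  exists (D : Type) (le : D -> D -> Prop) (t : D -> S) (z : X),
    [/\ directed le,
        (fun n => act (t n) x) @ net_filter le --> z &
        (fun n => act (t n) y) @ net_filter le --> z].

Definition distal_point (S : Type) (X : topologicalType) (act : S -> X -> X)
    (x : X) : Prop :=
  forall y, closure (orbit act x) y -> y <> x -> ~ proximal act x y.

Definition point_distal (S : Type) (X : topologicalType)
    (act : S -> X -> X) : Prop :=
  exists x, distal_point act x /\ dense (orbit act x).

Definition homeomorphism (X : topologicalType) (f : X -> X) : Prop :=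
  exists g, [/\ cancel f g, cancel g f, continuous f & continuous g].

Definition homeo_group (X : topologicalType) (G : set (X -> X)) : Prop :=
  [/\ (forall f, G f -> homeomorphism f),
      G id,
      (forall f g, G f -> G g -> G (f \o g)) &
      forall f g, G f -> cancel f g -> cancel g f -> G g].

(* Meaningful only when each act t is a homeomorphism, as for an invertible
   semiflow on a compact Hausdorff space. *)
Definition generated_group (T : Type) (X : topologicalType)
    (act : T -> X -> X) : set (X -> X) :=
  smallest (@homeo_group X) (range act).

Definition generated_flow (T : Type) (X : topologicalType)
    (act : T -> X -> X) (g : generated_group act) : X -> X :=
  val g.

(* When act t is bijective, 'pinv_id [set: X] (act t) is its inverse. *)
Definition reflection (T : Type) (X : topologicalType) (act : T -> X -> X)
    (t : T) : X -> X :=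
  'pinv_id [set: X] (act t).

(* Main.v *)
(* Let x be a distal point. By idempotents in the enveloping semigroup, (x, y)
   is almost periodic for every almost periodic y, so its orbit closure N is
   minimal. If N is mapped onto itself by each generator, it is invariant under
   the whole group, and then x and y can only be proximal under the group when
   N lies in the diagonal, that is, x = y.

   For the semiflow, amenability makes every minimal set M satisfy tM = M: the
   complement of tM in M is an open null set for an invariant measure, whereas
   finitely many preimages of a nonempty open set cover M. For the reflection of
   an amenable semigroup no invariant measure is available on N; instead the
   orbit of x is assumed dense, and then N is invariant because the distal
   points are dense and N is minimal. Conversely, the orbit closure of a distal
   point x of the reflection contains Tx: the closed subsemigroup t^-1 E, with E
   the enveloping semigroup of the reflection, contains an idempotent, which
   fixes x. *)

Require Import Defs.
From HB Require Import structures.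
From mathcomp Require Import all_boot all_order all_algebra.
From mathcomp Require Import all_classical all_reals all_analysis.
Local Open Scope classical_set_scope.

Set Implicit Arguments.
Unset Strict Implicit.
Unset Printing Implicit Defensive.

(* MathComp's [fingraph] also defines an [orbit]. *)
Local Notation orbit := Defs.orbit.

(** * Compact spaces and pointwise convergence *)

Lemma closure_sub_closed (X : topologicalType) (A B : set X) :
  closed B -> A `<=` B -> closure A `<=` B.
Proof. by move=> cB /closureS AB; rewrite [X in _ `<=` X](closure_id B).1. Qed.

Lemma closed_preimage (X Y : topologicalType) (f : X -> Y) (A : set Y) :
  continuous f -> closed A -> closed (f @^-1` A).
Proof. by move=> /continuous_closedP; exact. Qed.

Lemma open_preimage (X Y : topologicalType) (f : X -> Y) (A : set Y) :
  continuous f -> open A -> open (f @^-1` A).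
Proof. by move=> /continuousP; exact. Qed.

Lemma compact_image (X Y : topologicalType) (f : X -> Y) (A : set X) :
  continuous f -> compact A -> compact (f @` A).
Proof.
by move=> cf; apply: continuous_compact; exact: continuous_subspaceT.
Qed.

Lemma closed_compactT (X : topologicalType) (A : set X) :
  compact [set: X] -> closed A -> compact A.
Proof. by move=> cX cA; apply: subclosed_compact cA cX _. Qed.

Lemma closed_image (X Y : topologicalType) (f : X -> Y) (A : set X) :
  compact [set: X] -> hausdorff_space Y -> continuous f ->
  closed A -> closed (f @` A).
Proof.
move=> cX hY cf cA; apply: compact_closed hY _.
by apply: compact_image cf _; exact: closed_compactT.
Qed.

Lemma compact_setT_prod (X Y : topologicalType) :
  compact [set: X] -> compact [set: Y] -> compact [set: X * Y].
Proof. by move=> cX cY; rewrite -setXTT; exact: compact_setX. Qed.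

Lemma continuous_pair (Z X Y : topologicalType) (f : Z -> X) (g : Z -> Y) :
  continuous f -> continuous g -> continuous (fun z => (f z, g z)).
Proof. by move=> cf cg z; apply: cvg_pair; [exact: cf|exact: cg]. Qed.

Lemma continuous_fst (X Y : topologicalType) : continuous (@fst X Y).
Proof. by move=> p; exact: cvg_fst. Qed.

Lemma continuous_snd (X Y : topologicalType) : continuous (@snd X Y).
Proof. by move=> p; exact: cvg_snd. Qed.

Lemma hausdorff_prod (X Y : topologicalType) :
  hausdorff_space X -> hausdorff_space Y -> hausdorff_space (X * Y)%type.
Proof.
move=> hX hY [x y] [x' y'] clu; congr pair.
  apply: hX => A B Ax Bx'.
  have [||p [pA pB]] := clu (fst @^-1` A) (fst @^-1` B).
  - exact: continuous_fst.
  - exact: continuous_fst.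
  - by exists p.1.
apply: hY => A B Ay By'.
have [||p [pA pB]] := clu (snd @^-1` A) (snd @^-1` B).
- exact: continuous_snd.
- exact: continuous_snd.
- by exists p.2.
Qed.

Lemma closed_diagonal (X : topologicalType) :
  hausdorff_space X -> closed [set p : X * X | p.1 = p.2].
Proof.
move=> hX [x y] cl; apply: hX => A B Ax By.
have [|[u v] /= [-> [Av Bv]]] := cl (A `*` B); first by exists (A, B).
by exists v.
Qed.

Lemma directed_closed_inter (X : topologicalType) (F : set (set X)) :
  compact [set: X] -> F !=set0 ->
  (forall A, F A -> closed A /\ A !=set0) ->
  (forall A B, F A -> F B -> exists2 C, F C & C `<=` A `&` B) ->
  exists p, forall A, F A -> A p.
Proof.
move=> cX [A0 FA0] Fcl Fdir.
have FF : ProperFilter (filter_from F id).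
  apply: filter_from_proper; last by move=> A /Fcl[].
  by apply: filter_from_filter => //; exists A0.
have [|p [_ clp]] := cX _ FF; first exact: filterT.
exists p => A FA; have [cA _] := Fcl _ FA.
by apply: cA => B /clp; apply; exists A.
Qed.

Lemma finite_open_cover (X : topologicalType) (I : choiceType)
    (f : I -> set X) :
  compact [set: X] -> (forall i, open (f i)) -> (forall x, exists i, f i x) ->
  exists s : seq I, forall x, exists2 i, i \in s & f i x.
Proof.
move=> cX fo fcov; apply: contrapT => nocov.
pose c (s : seq I) := [set x | forall i, i \in s -> ~ f i x].
have [|||p cp] := @directed_closed_inter X (range c) cX.
- by exists (c [::]); exists [::].
- move=> _ [s _ <-]; split.
    rewrite (_ : c s = \bigcap_(i in [set i | i \in s]) ~` f i) //.
    by apply: closed_bigI => i _; exact: open_closedC.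
  apply: contrapT => c0; apply: nocov; exists s => x.
  apply: contrapT => nx; apply: c0; exists x => i si fix_; apply: nx.
  by exists i.
- move=> _ _ [s _ <-] [t _ <-]; exists (c (s ++ t)); first by exists (s ++ t).
  by move=> x cx; split=> i si; apply: cx; rewrite mem_cat si ?orbT.
have [i fip] := fcov p.
by apply: (cp (c [:: i]) _ i) fip; [exists [:: i]|rewrite inE].
Qed.

Lemma dense_finite_inter (X : topologicalType) (I : eqType) (s : seq I)
    (f : I -> set X) :
  (forall i, i \in s -> open (f i) /\ dense (f i)) ->
  open [set x | forall i, i \in s -> f i x] /\
  dense [set x | forall i, i \in s -> f i x].
Proof.
elim: s => [_|i s IH fs].
  rewrite (_ : [set _ | _] = [set: X]); last by apply/seteqP.
  by split; [exact: openT|move=> U U0 _; rewrite setIT].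
have [j sj|os ds] := IH; first by apply: fs; rewrite inE sj orbT.
have [oi di] := fs i (mem_head _ _).
rewrite (_ : [set _ | _] = f i `&` [set x | forall i, i \in s -> f i x]).
  by split; [exact: openI|exact: denseI].
apply/seteqP; split=> [x fx|x [fi fx] j].
  split=> [|j sj]; apply: fx; rewrite inE ?eqxx ?sj ?orbT//.
by rewrite inE => /predU1P[->//|]; exact: fx.
Qed.

Lemma ptws_continuous (Z : topologicalType) (I : Type) (X : topologicalType)
    (f : Z -> {ptws I -> X}) :
  (forall i, continuous (fun z => f z i)) -> continuous f.
Proof.
move=> cf z; apply/cvg_sup => i A.
move=> -[_ [[B oB <-] Bz] BA]; apply: filterS BA _.
by apply: (cf i z); exact: open_nbhs_nbhs.
Qed.

Lemma ptws_eval_continuous (I : eqType) (X : topologicalType) (i : I) :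
  continuous (fun p : {ptws I -> X} => p i).
Proof. exact: (@proj_continuous I (fun=> X) i). Qed.

Lemma compact_ptws (I : eqType) (X : topologicalType) :
  compact [set: X] -> compact [set: {ptws I -> X}].
Proof.
move=> cX; have := @tychonoff I (fun=> X) (fun=> setT) (fun=> cX).
by rewrite (_ : [set f | _] = setT) //; apply/seteqP.
Qed.

Lemma hausdorff_ptws (I : eqType) (X : topologicalType) :
  hausdorff_space X -> hausdorff_space {ptws I -> X}.
Proof. by move=> hX; exact: (@hausdorff_product I (fun=> X)). Qed.

(* Right composition is continuous for pointwise convergence, whatever [q];
   left composition only when the left factor is continuous. *)
Lemma comp_right_continuous (X : topologicalType) (q : X -> X) :
  continuous (fun p : {ptws X -> X} => (p \o q : {ptws X -> X})).
Proof. by apply: ptws_continuous => x; exact: ptws_eval_continuous. Qed.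

Lemma comp_left_continuous (X : topologicalType) (f : X -> X) :
  continuous f ->
  continuous (fun p : {ptws X -> X} => (f \o p : {ptws X -> X})).
Proof.
move=> cf; apply: ptws_continuous => x p.
by apply: (@continuous_comp _ _ _ (fun p : {ptws X -> X} => p x) f);
  [exact: ptws_eval_continuous|exact: cf].
Qed.

(** * Idempotents in closed semigroups of self-maps *)

Definition closed_semigroup (X : topologicalType) (A : set {ptws X -> X}) :=
  [/\ closed A, A !=set0 & forall p q, A p -> A q -> A (p \o q)].

(** Zorn gives a minimal closed subsemigroup M of [A]. For [p] in M, minimality shows first that the
    maps [q \o p] with [q] in M fill M, then that every [q] in M satisfies [q \o p = p]; taking
    [q = p] gives an idempotent. Both steps rest on continuity of right composition. *)
Lemma ellis_numakura (X : topologicalType) (A : set {ptws X -> X}) :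
  compact [set: X] -> hausdorff_space X -> closed_semigroup A ->
  exists2 u, A u & u \o u = u.
Proof.
move=> cX hX sA; have cE := @compact_ptws X X cX.
have hE := @hausdorff_ptws X X hX.
(* [Zorn_bigcup] yields maximal sets, so [good] is a condition on the complement of the subsemigroup
   sought. *)
pose good (U : set {ptws X -> X}) := closed_semigroup (~` U `&` A).
have [F Fgood Ftot|U [[cO [p [nOp Ap]] sO] Omax]] := @Zorn_bigcup _ good.
  have [->|F0] := eqVneq F set0.
    by rewrite /good bigcup_set0 setC0 setTI.
  pose G := [set ~` U `&` A | U in F].
  have [U0 FU0] : F !=set0 by exact/set0P.
  have mem q : (~` (\bigcup_(U in F) U) `&` A) q <-> forall B, G B -> B q.
    split=> [[nq Aq] _ [U FU <-]|Gq].
      by split=> // Oq; apply: nq; exists U.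
    have /(_ (~` U0 `&` A))[|_ Aq] := Gq; first by exists U0.
    split=> // -[U FU Oq]; have /(_ (~` U `&` A))[|//] := Gq.
    by exists U.
  split.
  - rewrite (_ : _ `&` _ = \bigcap_(B in G) B).
      by apply: closed_bigI => _ [U FU <-]; have [] := Fgood _ FU.
    by apply/seteqP; split=> q /mem.
  - have [|||q Gq] := @directed_closed_inter _ G cE.
    + by exists (~` U0 `&` A); exists U0.
    + by move=> _ [U FU <-]; have [] := Fgood _ FU.
    + move=> _ _ [U FU <-] [U' FU' <-].
      have [OO'|OO'] := Ftot _ _ FU FU'.
        exists (~` U' `&` A); first by exists U'.
        by move=> q [nq Aq]; split; split=> // /OO'.
      exists (~` U `&` A); first by exists U.
      by move=> q [nq Aq]; split; split=> // /OO'.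
    by exists q; apply/mem.
  - move=> q r /mem Gq /mem Gr; apply/mem => _ [U FU <-].
    have [_ _ sO] := Fgood _ FU.
    by apply: sO; [apply: Gq|apply: Gr]; exists U.
have minA (B : set {ptws X -> X}) :
    closed_semigroup B -> B `<=` ~` U `&` A -> ~` U `&` A `<=` B.
  move=> sB BA q Mq; apply: contrapT => nBq.
  have BE : ~` ~` B `&` A = B.
    rewrite setCK; apply/seteqP; split=> [r []//|r Br].
    by split=> //; case: (BA r).
  apply: (Omax (~` B)); last by rewrite /good BE.
  split=> [r Or Br|]; first by case: (BA r Br).
  by move=> /(_ q nBq); case: Mq.
have Mp : (~` U `&` A) p by [].
have MpE : ~` U `&` A `<=` [set q \o p | q in ~` U `&` A].
  apply: minA; last by move=> _ [q Mq <-]; exact: sO.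
  split.
  - apply: (@closed_image {ptws X -> X} {ptws X -> X}) cE hE _ cO.
    exact: comp_right_continuous.
  - by exists (p \o p); exists p.
  - move=> _ _ [q Mq <-] [r Mr <-]; exists (q \o (p \o r)) => //.
    by apply: (sO) => //; exact: sO.
have [q Mq qpE] := MpE p Mp.
have /(_ p Mp)[_ ppE] :
    ~` U `&` A `<=` (~` U `&` A) `&` [set q : {ptws X -> X} | q \o p = p].
  apply: minA; last by move=> r [].
  split.
  - apply: closedI => //.
    apply: (@closed_preimage {ptws X -> X} {ptws X -> X} _ [set p]).
      exact: comp_right_continuous.
    exact/accessible_closed_set1/hausdorff_accessible.
  - by exists q.
  - move=> r t [Mr rp] [Mt tp]; split; first exact: sO.
    by rewrite /= -compA tp.
by exists p.
Qed.

(** * Enveloping semigroups and distal points *)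

Lemma closure_image (X Y : topologicalType) (f : X -> Y) (A : set X) :
  compact [set: X] -> hausdorff_space Y -> continuous f ->
  closure (f @` A) = f @` closure A.
Proof.
move=> cX hY cf; apply/seteqP; split.
  apply: closure_sub_closed; first exact/closed_image/closed_closure.
  by apply: image_subset; exact: subset_closure.
move=> _ [x clx <-]; move: x clx; apply: closure_sub_closed.
  exact/(closed_preimage cf)/closed_closure.
by move=> x Ax; apply: subset_closure; exists x.
Qed.

(** Closure under composition is asked of the maps rather than of the indices, so that the
    reflection, whose product is reversed, is covered together with the semiflow and the diagonal
    actions. *)
Definition transformation_monoid (S : Type) (X : topologicalType)
    (act : S -> X -> X) : Prop :=
  [/\ exists e, act e = id, forall s t, exists r, act r = act s \o act t &
      forall s, continuous (act s)].

Definition diag (X : Type) (f : X -> X) (p : X * X) : X * X := (f p.1, f p.2).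

Definition diag_act (S X : Type) (act : S -> X -> X) (s : S) : X * X -> X * X :=
  diag (act s).

(** The Ellis semigroup; its elements need not be continuous. *)
Definition enveloping (S : Type) (X : topologicalType) (act : S -> X -> X) :
    set {ptws X -> X} :=
  @closure {ptws X -> X} (range act).

(** For a transformation monoid, equivalent to minimality of the orbit closure of [x]. *)
Definition almost_periodic (S : Type) (X : topologicalType)
    (act : S -> X -> X) (x : X) : Prop :=
  forall y, closure (orbit act x) y -> closure (orbit act y) x.

Lemma diag_continuous (X : topologicalType) (f : X -> X) :
  continuous f -> continuous (diag f).
Proof.
move=> cf; apply: continuous_pair => p.
  by apply: continuous_comp; [exact: continuous_fst|exact: cf].
by apply: continuous_comp; [exact: continuous_snd|exact: cf].
Qed.

Lemma diag_act_monoid (S : Type) (X : topologicalType) (act : S -> X -> X) :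
  transformation_monoid act -> transformation_monoid (diag_act act).
Proof.
case=> [[e ae] am ac]; split.
- by exists e; apply/funext => -[x y]; rewrite /diag_act /diag ae.
- move=> s t; have [r ar] := am s t; exists r.
  by apply/funext => -[x y]; rewrite /diag_act /diag ar.
- by move=> s; exact: diag_continuous.
Qed.

Lemma orbit_refl (S : Type) (X : topologicalType) (act : S -> X -> X) x :
  transformation_monoid act -> orbit act x x.
Proof. by case=> [[e ae] _ _]; exists e; rewrite ?ae. Qed.

Lemma closure_orbit_refl (S : Type) (X : topologicalType)
    (act : S -> X -> X) x :
  transformation_monoid act -> closure (orbit act x) x.
Proof. by move=> /orbit_refl ax; exact: subset_closure. Qed.

Lemma closure_orbit_sub (S : Type) (X : topologicalType) (act : S -> X -> X)
    (A : set X) x :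
  closed A -> (forall s, A (act s x)) -> closure (orbit act x) `<=` A.
Proof. by move=> cA Ax; apply: closure_sub_closed cA _ => _ [s _ <-]. Qed.

Lemma closure_orbit_act (S : Type) (X : topologicalType)
    (act : S -> X -> X) x y s :
  transformation_monoid act -> closure (orbit act x) y ->
  closure (orbit act x) (act s y).
Proof.
case=> _ am ac; move: y; apply: closure_orbit_sub.
  exact/(closed_preimage (ac s))/closed_closure.
move=> t; have [r ar] := am s t.
by apply: subset_closure; exists r; rewrite ?ar.
Qed.

Lemma closure_orbit_trans (S : Type) (X : topologicalType)
    (act : S -> X -> X) x y z :
  transformation_monoid act -> closure (orbit act x) y ->
  closure (orbit act y) z -> closure (orbit act x) z.
Proof.
move=> ma xy; apply: closure_orbit_sub; first exact: closed_closure.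
by move=> s; exact: closure_orbit_act.
Qed.

Lemma almost_periodic_closure (S : Type) (X : topologicalType)
    (act : S -> X -> X) x y :
  transformation_monoid act -> almost_periodic act x ->
  closure (orbit act x) y -> almost_periodic act y.
Proof.
move=> ma apx xy z yz; apply: (closure_orbit_trans ma _ xy).
by apply: apx; exact: closure_orbit_trans yz.
Qed.

Lemma closure_orbitE (S : Type) (X : topologicalType) (act : S -> X -> X) x :
  compact [set: X] -> hausdorff_space X ->
  closure (orbit act x) = [set p x | p in enveloping act].
Proof.
move=> cX hX; rewrite /enveloping.
rewrite -(@closure_image {ptws X -> X} X (fun p => p x)) //.
- by rewrite image_comp.
- exact: compact_ptws.
- exact: (@ptws_eval_continuous X X x).
Qed.

Lemma closure_diag_orbitE (S : Type) (X : topologicalType)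
    (act : S -> X -> X) x y :
  compact [set: X] -> hausdorff_space X ->
  closure (orbit (diag_act act) (x, y)) =
    [set (p x, p y) | p in enveloping act].
Proof.
move=> cX hX; rewrite /enveloping.
rewrite -(@closure_image {ptws X -> X} (X * X)%type (fun p => (p x, p y))) //.
- by rewrite image_comp.
- exact: compact_ptws.
- exact: hausdorff_prod.
- by apply: continuous_pair; exact: ptws_eval_continuous.
Qed.

(** The closure is taken in one factor at a time: first in [p], by continuity of right composition,
    then in [q] with [p] already an acting map and hence continuous. *)
Lemma enveloping_comp (S : Type) (X : topologicalType) (act : S -> X -> X) p q :
  transformation_monoid act ->
  enveloping act p -> enveloping act q -> enveloping act (p \o q).
Proof.
case=> _ am ac Ep Eq; move: p Ep; apply: closure_sub_closed.
  exact/(closed_preimage (@comp_right_continuous X q))/closed_closure.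
move=> _ [s _ <-]; move: q Eq; apply: closure_sub_closed.
  exact/(closed_preimage (comp_left_continuous (ac s)))/closed_closure.
move=> _ [t _ <-]; have [r ar] := am s t.
by apply: subset_closure; exists r.
Qed.

Lemma proximalP (S : Type) (X : topologicalType) (act : S -> X -> X) x y :
  proximal act x y <-> exists z, closure (orbit (diag_act act) (x, y)) (z, z).
Proof.
split=> [[D [le [t [z [[_ ler letr led] tx ty]]]]]|[z clz]].
  exists z => A [[U V] /= [Uz Vz] UVA].
  have [a _ aU] := tx _ Uz; have [b _ bV] := ty _ Vz.
  have [c [ac bc]] := led a b.
  exists (act (t c) x, act (t c) y); split; first by exists (t c).
  by apply: UVA; split; [apply: aU|apply: bV].
(* The net is indexed by the neighbourhoods of [z] ordered by reverse inclusion. *)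
pose D := {U : set X | nbhs z U}.
have /choice[t tP] (U : D) : exists s, sval U (act s x) /\ sval U (act s y).
  case: U => U Uz; have [|_ [[s _ <-] /= [Ux Uy]]] := clz (U `*` U).
    by exists (U, U).
  by exists s.
exists D, (fun U V => sval V `<=` sval U), t, z; split.
- split.
  + by constructor; exists setT; exact: filterT.
  + by move=> U.
  + by move=> U V W UV VW; exact: subset_trans UV.
  + move=> [U Uz] [V Vz].
    by exists (exist _ (U `&` V) (filterI Uz Vz)); split => w [].
- move=> U Uz; exists (exist _ U Uz) => // V /= VU.
  by apply: VU; have [] := tP V.
- move=> U Uz; exists (exist _ U Uz) => // V /= VU.
  by apply: VU; have [] := tP V.
Qed.

(** As [u (u x) = u x], the points [x] and [u x] are proximal, and [u x] lies in the orbit closure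
    of the distal point [x]. *)
Lemma idempotent_fixes_distal (S : Type) (X : topologicalType)
    (act : S -> X -> X) x (u : {ptws X -> X}) :
  compact [set: X] -> hausdorff_space X -> distal_point act x ->
  enveloping act u -> u \o u = u -> u x = x.
Proof.
move=> cX hX dx Eu uu; apply: contrapT => ux.
apply: (dx (u x)) => //; first by rewrite closure_orbitE //; exists u.
apply/proximalP; exists (u x); rewrite closure_diag_orbitE //.
by exists u => //; rewrite -[u (u x)]/((u \o u) x) uu.
Qed.

(** Some [q] returning [p y] to [y] has [q \o p] idempotent; that idempotent fixes [x] by distality,
    so [q] returns [(p x, p y)] to [(x, y)]. *)
Lemma distal_diag_almost_periodic (S : Type) (X : topologicalType)
    (act : S -> X -> X) x y :
  compact [set: X] -> hausdorff_space X -> transformation_monoid act ->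
  distal_point act x -> almost_periodic act y ->
  almost_periodic (diag_act act) (x, y).
Proof.
move=> cX hX ma dx apy z; rewrite closure_diag_orbitE // => -[p Ep <-].
have cE := @compact_ptws X X cX; have hE := @hausdorff_ptws X X hX.
(* Almost periodicity of [y] makes [B] nonempty, and [B] is stable under [q \o (p \o r)] because [r]
   returns [p y] to [y]. *)
pose B := enveloping act `&` [set q : {ptws X -> X} | q (p y) = y].
have [u [q [Eq qpy] <-] uu] :
    exists2 u, [set (q \o p : {ptws X -> X}) | q in B] u & u \o u = u.
  apply: ellis_numakura => //; split.
  - apply: (@closed_image {ptws X -> X} {ptws X -> X}) => //.
      exact: comp_right_continuous.
    apply: closedI; first exact: closed_closure.
    apply: (@closed_preimage {ptws X -> X} X (fun q => q (p y)) [set y]).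
      exact: ptws_eval_continuous.
    exact/accessible_closed_set1/hausdorff_accessible.
  - have : closure (orbit act (p y)) y.
      by apply: apy; rewrite closure_orbitE //; exists p.
    by rewrite closure_orbitE // => -[q Eq qpy]; exists (q \o p); exists q.
  - move=> _ _ [q [Eq /= qpy] <-] [r [Er /= rpy] <-].
    exists (q \o (p \o r)) => //; split=> /=; last by rewrite rpy.
    by do 2!apply: enveloping_comp => //.
have qpx : q (p x) = x.
  apply: (@idempotent_fixes_distal S X act x (q \o p)) => //.
  exact: enveloping_comp.
by rewrite closure_diag_orbitE //; exists q => //; rewrite qpx qpy.
Qed.

(** The maps [q \o p] form a closed semigroup; an idempotent in it fixes [x], so its factor [q]
    returns [p x] to [x]. *)
Lemma distal_almost_periodic (S : Type) (X : topologicalType)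
    (act : S -> X -> X) x :
  compact [set: X] -> hausdorff_space X -> transformation_monoid act ->
  distal_point act x -> almost_periodic act x.
Proof.
move=> cX hX ma dx y; rewrite closure_orbitE // => -[p Ep <-].
have cE := @compact_ptws X X cX; have hE := @hausdorff_ptws X X hX.
have [u [q Eq <-] uu] :
    exists2 u, [set (q \o p : {ptws X -> X}) | q in enveloping act] u &
      u \o u = u.
  apply: ellis_numakura => //; split.
  - apply: (@closed_image {ptws X -> X} {ptws X -> X}) => //.
      exact: comp_right_continuous.
    exact: closed_closure.
  - by exists (p \o p); exists p.
  - move=> _ _ [q Eq <-] [r Er <-]; exists (q \o (p \o r)) => //.
    by do 2!apply: enveloping_comp => //.
rewrite closure_orbitE //; exists q => //.
apply: (@idempotent_fixes_distal S X act x (q \o p)) => //.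
exact: enveloping_comp.
Qed.

(* The closed subsemigroup [act s \o enveloping act] contains an idempotent,
   and that idempotent fixes [x]. *)
Lemma distal_preimage_closure (S : Type) (X : topologicalType)
    (act : S -> X -> X) x y s :
  compact [set: X] -> hausdorff_space X -> transformation_monoid act ->
  injective (act s) -> distal_point act x -> act s y = x ->
  closure (orbit act x) y.
Proof.
move=> cX hX ma inj_s dx sy.
have cE := @compact_ptws X X cX; have hE := @hausdorff_ptws X X hX.
have [_ _ ac] := ma.
have Es : enveloping act (act s) by apply: subset_closure; exists s.
have [u [q Eq <-] uu] :
    exists2 u, [set (act s \o q : {ptws X -> X}) | q in enveloping act] u &
      u \o u = u.
  apply: ellis_numakura => //; split.
  - apply: (@closed_image {ptws X -> X} {ptws X -> X}) => //.
      exact: comp_left_continuous.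
    exact: closed_closure.
  - by exists (act s \o act s); exists (act s).
  - move=> _ _ [q Eq <-] [r Er <-]; exists (q \o (act s \o r)) => //.
    by do 2!apply: enveloping_comp => //.
rewrite closure_orbitE //; exists q => //; apply: inj_s; rewrite sy.
apply: (@idempotent_fixes_distal S X act x (act s \o q)) => //.
exact: enveloping_comp.
Qed.

Lemma dense_closure (X : topologicalType) (A : set X) x :
  dense A -> closure A x.
Proof.
move=> dA U; rewrite nbhsE => -[V [oV Vx] VU].
have [|z [Vz Az]] := dA V _ oV; first by exists x.
by exists z; split=> //; exact: VU.
Qed.

Lemma closure_dense (X : topologicalType) (A : set X) :
  (forall x, closure A x) -> dense A.
Proof.
move=> clA U [x Ux] oU; have [|z [Az Uz]] := clA x U.
  exact: open_nbhs_nbhs.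
by exists z.
Qed.

(* Write [N] for the orbit closure of [(x, y)]. Distal points are dense, and
   over each of them the fibre of the preimage of [N] under [act s] is already
   contained in [N]. As [N] is minimal, the first projection of a closed subset
   of [N] with nonempty relative interior cannot avoid the image of that dense
   set under [act s], whence [act s] maps [N] onto itself. *)
Lemma distal_diag_orbit_surj (S : choiceType) (X : topologicalType)
    (act : S -> X -> X) x y s :
  compact [set: X] -> hausdorff_space X -> transformation_monoid act ->
  (forall t, homeomorphism (act t)) ->
  distal_point act x -> dense (orbit act x) ->
  closure (orbit (diag_act act) (x, y)) `<=`
    diag (act s) @` closure (orbit (diag_act act) (x, y)).
Proof.
move=> cX hX ma hact dx densex; set N := closure _.
have ma2 := diag_act_monoid ma.
have apx := distal_almost_periodic cX hX ma dx.
have full z w : closure (orbit act z) w.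
  by apply: (closure_orbit_trans ma (apx z _)); exact: dense_closure.
have ap2 d w : distal_point act d -> almost_periodic (diag_act act) (d, w).
  by move=> dd; apply: distal_diag_almost_periodic.
(* Distality passes along the orbit: if [act t d] and [w] are proximal, so are [d] and [g w]. *)
have dact d t : distal_point act d -> distal_point act (act t d).
  have [g [gK Kg _ _]] := hact t.
  move=> dd w _ wd /proximalP[z clz]; apply: (dd (g w)) => //.
    by move=> gwd; apply: wd; rewrite -gwd Kg.
  apply/proximalP; exists z; apply: (closure_orbit_trans ma2 _ clz).
  have -> : (act t d, w) = diag_act act t (d, g w).
    by rewrite /diag_act /diag /= Kg.
  by apply: closure_orbit_act => //; exact: closure_orbit_refl.
have [g [gK Kg _ _]] := hact s.
have pullN d w : distal_point act d -> N (act s d, act s w) -> N (d, w).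
  move=> dd Nsdw; apply: (closure_orbit_trans ma2 Nsdw).
  apply: ap2 => //; rewrite -[(act s d, _)]/(diag_act act s (d, w)).
  by apply: closure_orbit_act => //; exact: closure_orbit_refl.
have cN : closed N by exact: closed_closure.
have cX2 := compact_setT_prod cX cX; have hX2 := hausdorff_prod hX hX.
have cact t : continuous (act t) by case: ma.
have cdact t : continuous (diag_act act t) by exact: diag_continuous.
have cN' : closed (diag (act s) @` N).
  by apply: closed_image => //; exact: (cdact s).
move=> n0 Nn0; apply: contrapT => N'n0.
have [|V n0V clV] := @compact_regular _ n0 setT hX2 cX2 filterT
    (~` (diag (act s) @` N)).
  by apply: open_nbhs_nbhs; split=> //; exact: closed_openC.
(* Points of [N] are sorted by the times at which they enter the interior of [V]; the complement of
   [N] is added to cover all of [X * X]. *)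
pose f t := [set n | V° (diag_act act t n)] `|` ~` N.
have [t|n|ts tsP] := @finite_open_cover _ S f cX2.
- apply: openU; last exact: closed_openC.
  exact/(open_preimage (cdact t))/open_interior.
- have [Nn|] := pselect (N n); last by exists s; right.
  have n0n : closure (orbit (diag_act act) n) n0.
    exact: (closure_orbit_trans ma2 (ap2 x y dx n Nn)).
  have [|_ [[t _ <-] Vt]] := n0n V°.
    by apply: open_nbhs_nbhs; split=> //; exact: open_interior.
  by exists t; left.
(* [C] misses the image under [act s] of the orbit of [x]: by [pullN], a point of [N] above that
   image comes from a point of [N], hence is outside [closure V]. *)
pose C := fst @` (N `&` closure V).
have cC : closed C.
  apply: closed_image => //; first exact: continuous_fst.
  by apply: closedI => //; exact: closed_closure.
have [t tts|_ dA] := @dense_finite_inter _ _ ts (fun t => ~` (act t @^-1` C)).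
  split; first exact/closed_openC/(closed_preimage (cact t)).
  have [h [hK Kh _ ch]] := hact t.
  move=> U [v Uv] oU.
  have [||d [Ud [r _ rd]]] := densex [set d | U (h (act s d))].
  - by exists (g (act t v)); rewrite /= Kg hK.
  - apply: (open_preimage (f := h \o act s)) oU => z.
    by apply: continuous_comp; [exact: cact|exact: ch].
  exists (h (act s d)); split=> // -[[c1 w] [Nc Vc] /= c1E].
  apply: (clV _ Vc); exists (d, g w); last by rewrite /diag /= Kg c1E Kh.
  apply: pullN; first by rewrite -rd; exact: dact.
  by rewrite Kg -(Kh (act s d)) -c1E.
(* [z] avoids the preimages of [C] for all [t] in [ts], yet a point of [N] above [z] enters [V] at
   some such [t]. *)
have [||z [_ zA]] := dA setT; [by exists x|exact: openT|].
have [[z' w] Nzw /= zz'] : (fst @` N) z.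
  have : closure (orbit act x) z by [].
  apply: closure_orbit_sub => [|t].
    by apply: closed_image => //; exact: continuous_fst.
  by exists (act t x, act t y) => //; apply: subset_closure; exists t.
subst z'; have [t tts [Vt|//]] := tsP (z, w).
apply: (zA t tts); exists (act t z, act t w) => //; split.
  by rewrite -[(act t z, _)]/(diag_act act t (z, w)); exact: closure_orbit_act.
exact/subset_closure/(interior_subset Vt).
Qed.

(** * Amenability and minimal sets *)

Lemma semiflow_monoid (T : monoidType) (X : topologicalType)
    (act : T -> X -> X) :
  semiflow act -> transformation_monoid act.
Proof.
case=> ca a1 aM; split.
- by exists 1%g; apply/funext.
- by move=> s t; exists (s * t)%g; apply/funext => x; rewrite /= aM.
- move=> t; pose f (x : X) : discrete_topology T * X := (t, x).
  have cf : continuous f.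
    by apply: continuous_pair => y; [exact: cvg_cst|exact: cvg_id].
  by move=> x; exact: (continuous_comp (cf x) (ca (f x))).
Qed.

(** Singletons of the discrete space of times are open, so continuity of each [act t] gives joint
    continuity. *)
Lemma semiflow_discrete (T : monoidType) (X : topologicalType)
    (act : T -> X -> X) :
  (forall t, continuous (act t)) -> (forall x, act 1%g x = x) ->
  (forall t s x, act t (act s x) = act (t * s)%g x) -> semiflow act.
Proof.
move=> ca a1 aM; split=> // -[t x] A /= /(ca t x) Ax.
exists ([set t], act t @^-1` A); last by move=> [_ z] /= [-> ].
by split=> //; exact: discrete_set1.
Qed.

Lemma measurable_null_finite_union d (Y : measurableType d) (R : realType)
    (mu : {measure set Y -> \bar R}%R) (I : eqType) (s : seq I)
    (f : I -> set Y) :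
  (forall i, measurable (f i) /\ mu (f i) = 0%E) ->
  measurable [set y | exists2 i, i \in s & f i y] /\
  mu [set y | exists2 i, i \in s & f i y] = 0%E.
Proof.
move=> f0; elim: s => [|i s [ms s0]].
  rewrite (_ : [set _ | _] = set0); last by apply/seteqP; split=> // y [].
  by rewrite measure0.
have [mi i0] := f0 i.
rewrite (_ : [set _ | _] = f i `|` [set y | exists2 i, i \in s & f i y]).
  split; first exact: measurableU.
  by rewrite null_set_setU.
apply/seteqP; split=> y.
  by move=> [j]; rewrite inE => /predU1P[->|js] fj; [left|right; exists j].
by case=> [fi|[j js fj]]; [exists i|exists j]; rewrite // inE ?eqxx ?js ?orbT.
Qed.

(* The complement of [act t @` Y] is an open null set; were it nonempty,
   finitely many of its preimages, all null, would cover [Y]. *)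
Lemma amenable_minimal_surj (R : realType) (T : monoidType)
    (Y : ptopologicalType) (act : T -> Y -> Y) t :
  amenable R T -> compact [set: Y] -> hausdorff_space Y -> semiflow act ->
  (forall y z, closure (orbit act y) z) -> act t @` setT = setT.
Proof.
move=> amT cY hY sf minY; have [mu muE] := amT Y act cY hY sf.
have [_ _ ca] := semiflow_monoid sf.
pose U : set Y := ~` (act t @` setT).
have oU : open U by apply/closed_openC/closed_image.
have borel (V : set Y) : open V -> (@open Y).-sigma.-measurable V.
  by move=> oV; exact: sub_sigma_algebra.
have U0 : mu U = 0%E.
  (* No point is mapped outside the image, so invariance equates the measure of [U] with that of the
     empty set. *)
  have tU : act t @^-1` U = set0.
    by apply/seteqP; split=> // y; apply; exists y.
  by have := muE t U (borel _ oU); rewrite tU => ->; exact: measure0.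
apply/seteqP; split=> // y0 _; apply: contrapT => Uy0.
have [s|y|s sP] := @finite_open_cover Y T (fun s => act s @^-1` U) cY.
- exact: open_preimage.
- have [|_ [[r _ <-] Ur]] := minY y y0 U; first exact: open_nbhs_nbhs.
  by exists r.
have null r : (@open Y).-sigma.-measurable (act r @^-1` U) /\
    mu (act r @^-1` U) = 0%E.
  split; first by apply: borel; exact: open_preimage (ca r) oU.
  by rewrite -(muE r U (borel _ oU)).
have [_] := @measurable_null_finite_union _ (g_sigma_algebraType (@open Y)) R mu
  T s (fun r => act r @^-1` U) null.
rewrite (_ : [set _ | _] = setT).
  move=> mu0; have /eqP := etrans (esym (probability_setT mu)) mu0.
  by rewrite onee_eq0.
by apply/seteqP; split=> // y _; exact: sP.
Qed.

Lemma compact_set_type (X : topologicalType) (K : set X) :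
  compact K -> compact [set: set_type K].
Proof.
move=> cK F FF _.
have [|x [Kx clx]] := cK (set_val @ F) (fmap_proper_filter set_val FF).
  by apply: (@filterE _ F) => z; exact: set_valP.
exists (exist _ x (mem_set Kx)); split=> // A B FA [_ [[V oV <-] Vx] VB].
have [|_ [[z Az <-] Vz]] :=
  clx (set_val @` A) V _ (open_nbhs_nbhs (conj oV Vx)).
  by apply: (@filterS _ F _ A) => // z Az; exists z.
by exists z; split=> //; exact: VB.
Qed.

Lemma hausdorff_set_type (X : topologicalType) (K : set X) :
  hausdorff_space X -> hausdorff_space (set_type K).
Proof.
move=> hX y z clyz; apply: val_inj; apply: hX => A B Ay Bz.
have cv := @initial_continuous (set_type K) X set_val.
have [w [Aw Bw]] :=
  clyz (set_val @^-1` A) (set_val @^-1` B) (cv y _ Ay) (cv z _ Bz).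
by exists (set_val w).
Qed.

(** The minimal orbit closure is made a phase space of its own, with base point [x], so that
    amenability applies to the restricted action. *)
Lemma amenable_orbit_closure_surj (R : realType) (T : monoidType)
    (X : topologicalType) (act : T -> X -> X) x t :
  amenable R T -> compact [set: X] -> hausdorff_space X -> semiflow act ->
  almost_periodic act x ->
  act t @` closure (orbit act x) = closure (orbit act x).
Proof.
move=> amT cX hX sf apx; have ma := semiflow_monoid sf.
have [_ a1 aM] := sf; have [_ _ ca] := ma.
pose K := closure (orbit act x).
have Kact s (y : set_type K) : act s (set_val y) \in K.
  by apply/mem_set; apply: closure_orbit_act => //; exact: (set_valP y).
pose Kx : set_type K := exist _ x (mem_set (@closure_orbit_refl _ _ act x ma)).
pose Y : ptopologicalType :=
  HB.pack (set_type K) (isPointed.Build (set_type K) Kx).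
pose actY s (y : Y) : Y := exist _ (act s (set_val y)) (Kact s y).
have cval : continuous (set_val : Y -> X) by exact: initial_continuous.
have cactY s : continuous (actY s).
  move=> y B [_ [[V oV <-] Vy] VB].
  have : nbhs y ((act s \o (set_val : Y -> X)) @^-1` V).
    apply: (continuous_comp (cval y) (ca s _)).
    by apply: open_nbhs_nbhs; split.
  by apply: filterS => z Vz; exact: VB.
have sfY : semiflow actY.
  apply: semiflow_discrete => //.
    by move=> y; apply: val_inj; exact: a1.
  by move=> r s y; apply: val_inj; exact: aM.
have minY (y z : Y) : closure (orbit actY y) z.
  move=> B [_ [[V oV <-] Vz] VB].
  have yz : closure (orbit act (set_val y)) (set_val z).
    apply: (closure_orbit_trans ma (apx _ (set_valP y))).
    exact: (set_valP z).
  have [_ [[s _ <-] Vs]] := yz _ (open_nbhs_nbhs (conj oV Vz)).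
  by exists (actY s y); split; [exists s|exact: VB].
have cY : compact [set: Y].
  apply: compact_set_type; apply: closed_compactT cX _.
  exact: closed_closure.
have surj := amenable_minimal_surj t amT cY (hausdorff_set_type hX) sfY minY.
apply/seteqP; split=> [_ [y Ky <-]|y Ky]; first exact: closure_orbit_act.
have [z _ zy] : (actY t @` setT) (exist _ y (mem_set Ky) : Y) by rewrite surj.
by exists (set_val z); [exact: (set_valP z)|have := congr1 set_val zy].
Qed.

(** * The generated group and the reflection *)

Lemma semiflow_diag (T : monoidType) (X : topologicalType) (act : T -> X -> X) :
  semiflow act -> semiflow (diag_act act).
Proof.
move=> sf; have [_ _ ca] := diag_act_monoid (semiflow_monoid sf).
have [_ a1 aM] := sf; apply: semiflow_discrete => //.
  by move=> [x y]; rewrite /diag_act /diag !a1.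
by move=> t s [x y]; rewrite /diag_act /diag /= !aM.
Qed.

Lemma compact_bijective_homeomorphism (X : topologicalType) (f : X -> X) :
  compact [set: X] -> hausdorff_space X -> continuous f -> bijective f ->
  homeomorphism f.
Proof.
move=> cX hX cf [g fK gK]; exists g; split=> //.
apply/continuous_closedP => A cA; rewrite (_ : _ @^-1` _ = f @` A).
  exact: closed_image.
by apply/seteqP; split=> [x Agx|_ [x Ax <-]]; [exists (g x)|rewrite /= fK].
Qed.

Lemma reflectionK (T : Type) (X : topologicalType) (act : T -> X -> X) t :
  bijective (act t) ->
  cancel (reflection act t) (act t) /\ cancel (act t) (reflection act t).
Proof.
move=> bij_t; have [g actK gK] := bij_t.
have rK : cancel (reflection act t) (act t).
  by move=> x; apply: pinvK; apply/mem_set; exists (g x).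
by split=> // x; apply: (bij_inj bij_t); rewrite rK.
Qed.

Lemma reflection_monoid (T : monoidType) (X : topologicalType)
    (act : T -> X -> X) :
  compact [set: X] -> hausdorff_space X -> invertible_semiflow act ->
  transformation_monoid (reflection act).
Proof.
move=> cX hX [sf bij]; have [_ _ ca] := semiflow_monoid sf.
have [_ a1 aM] := sf.
split.
- exists 1%g; apply/funext => x; rewrite -[LHS]a1.
  by have [-> _] := reflectionK (bij 1%g).
(* Inverses reverse products, whence [t * s]. *)
- move=> s t; exists (t * s)%g; apply/funext => x.
  apply: (bij_inj (bij (t * s)%g)).
  have [-> _] := reflectionK (bij (t * s)%g); rewrite -aM /=.
  by have [-> _] := reflectionK (bij s); have [-> _] := reflectionK (bij t).
- move=> t; have [g [tK gK _ cg]] :=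
    compact_bijective_homeomorphism cX hX (ca t) (bij t).
  rewrite (_ : reflection act t = g) //; apply/funext => x.
  by rewrite -[x in LHS]gK; have [_ ->] := reflectionK (bij t).
Qed.

(** The generated group is an intersection over all groups containing the generators; this one
    bounds it. *)
Lemma homeomorphism_group (X : topologicalType) :
  homeo_group [set f : X -> X | homeomorphism f].
Proof.
split=> //.
- by exists id; split=> // x; exact: cvg_id.
- move=> f g [f' [fK f'K cf cf']] [g' [gK g'K cg cg']].
  exists (g' \o f'); split.
  + by move=> x; rewrite /= fK gK.
  + by move=> x; rewrite /= g'K f'K.
  + by move=> x; apply: continuous_comp; [exact: cg|exact: cf].
  + by move=> x; apply: continuous_comp; [exact: cf'|exact: cg'].
- move=> f g [f' [fK f'K cf cf']] fgK gfK; exists f; split=> //.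
  rewrite (_ : g = f') //; apply/funext => x.
  by rewrite -[x in LHS]f'K fgK.
Qed.

Lemma generated_homeo_group (T : Type) (X : topologicalType)
    (act : T -> X -> X) :
  (forall t, homeomorphism (act t)) -> homeo_group (generated_group act).
Proof.
move=> hact; split.
- apply: smallest_sub; first exact: homeomorphism_group.
  by move=> _ [t _ <-].
- by move=> M [[]].
- move=> f g Gf Gg M MG; have [[_ _ Mc _] _] := MG.
  exact: Mc (Gf M MG) (Gg M MG).
- move=> f g Gf fK gK M MG; have [[_ _ _ Mi] _] := MG.
  exact: Mi (Gf M MG) fK gK.
Qed.

Lemma generated_flow_surj (T : Type) (X : topologicalType)
    (act : T -> X -> X) f :
  generated_group act f -> exists g, @generated_flow T X act g = f.
Proof.
move=> Gf.
by exists (exist (fun f => f \in generated_group act) f (mem_set Gf)).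
Qed.

(** The homeomorphisms [f] for which [F f] maps [K] onto itself form a group containing the
    generators; equality, rather than inclusion, is what passes to inverses. [F] is the identity for
    subsets of [X] and [diag] for subsets of [X * X]. *)
Lemma generated_group_stable (T Z : Type) (X : topologicalType)
    (act : T -> X -> X) (F : (X -> X) -> Z -> Z) (K : set Z) :
  (forall t, homeomorphism (act t)) -> F id = id ->
  (forall f g, F (f \o g) = F f \o F g) ->
  (forall t, F (act t) @` K = K) ->
  forall f, generated_group act f -> F f @` K = K.
Proof.
move=> hact F1 FM FK f Gf.
suff [//] : (homeomorphism f /\ F f @` K = K).
move: f Gf; apply: smallest_sub; last by move=> _ [t _ <-].
have [_ H1 Hc Hi] := homeomorphism_group X; split.
- by move=> f [].
- by split=> //; rewrite F1 image_id.
- move=> f g [Hf Kf] [Hg Kg]; split; first exact: Hc.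
  by rewrite FM -image_comp Kg Kf.
- move=> f g [Hf Kf] fK gK; split; first exact: Hi fK gK.
  rewrite -{1}Kf image_comp -FM (_ : g \o f = id) ?F1 ?image_id //.
  exact/funext.
Qed.

Lemma distal_point_sub (S S' : Type) (X : topologicalType) (act : S -> X -> X)
    (act' : S' -> X -> X) x :
  (forall s, exists s', act s = act' s') ->
  distal_point act' x -> distal_point act x.
Proof.
move=> sub dx y xy yx /proximalP[z clz]; apply: (dx y) => //.
  by apply: closureS xy => _ [s _ <-]; have [s' ->] := sub s; exists s'.
apply/proximalP; exists z; apply: closureS clz => _ [s _ <-].
by have [s' e] := sub s; exists s'; rewrite // /diag_act e.
Qed.

Lemma dense_orbit_sub (S S' : Type) (X : topologicalType) (act : S -> X -> X)
    (act' : S' -> X -> X) x :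
  (forall s, exists s', act s = act' s') ->
  dense (orbit act x) -> dense (orbit act' x).
Proof.
move=> sub dx U U0 oU; have [z [Uz [s _ sz]]] := dx U U0 oU.
by exists z; split=> //; have [s' e] := sub s; exists s'; rewrite // -e.
Qed.

(** The stable orbit closure of [(x, y)] contains the diagonal point [(z, z)]; by minimality
    [(x, y)] is in the orbit closure of [(z, z)], which stays in the diagonal. *)
Lemma proximal_diag_stable (S S' : Type) (X : topologicalType)
    (act : S -> X -> X) (act' : S' -> X -> X) x y :
  hausdorff_space X -> transformation_monoid act ->
  almost_periodic (diag_act act) (x, y) ->
  (forall s', diag (act' s') @` closure (orbit (diag_act act) (x, y)) =
              closure (orbit (diag_act act) (x, y))) ->
  proximal act' x y -> x = y.
Proof.
move=> hX ma apxy stab /proximalP[z clz].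
have Nz : closure (orbit (diag_act act) (x, y)) (z, z).
  move: clz; apply: closure_orbit_sub; first exact: closed_closure.
  move=> s'; rewrite -(stab s'); exists (x, y) => //.
  by apply: closure_orbit_refl; exact: diag_act_monoid.
have := apxy _ Nz; rewrite -[x = y]/([set p : X * X | p.1 = p.2] (x, y)).
by apply: closure_orbit_sub => //; exact: closed_diagonal.
Qed.

(** * The three equivalences for an amenable invertible semiflow *)

Theorem theorem5p4 (R : realType) (T : monoidType) (X : topologicalType)
    (act : T -> X -> X) (x : X) :
  infinite_set [set: T] ->
  amenable R T ->
  compact [set: X] -> hausdorff_space X ->
  invertible_semiflow act ->
  [/\ distal_point act x <-> distal_point (@generated_flow T X act) x,
      point_distal act <-> point_distal (@generated_flow T X act) &
      point_distal (reflection act) <->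
      point_distal (@generated_flow T X act)].
Proof.
move=> _ amT cX hX inv; have [sf bij] := inv.
have ma := semiflow_monoid sf; have mr := reflection_monoid cX hX inv.
have [_ _ ca] := ma; have [_ _ cr] := mr.
have hact t : homeomorphism (act t) by exact: compact_bijective_homeomorphism.
have rK t : cancel (reflection act t) (act t) by case: (reflectionK (bij t)).
have Kr t : cancel (act t) (reflection act t) by case: (reflectionK (bij t)).
have hrefl t : homeomorphism (reflection act t) by exists (act t); split.
have [_ _ _ Gi] := generated_homeo_group hact.
have Gact t : generated_group act (act t) by apply: sub_gen_smallest; exists t.
have subT t : exists g, act t = @generated_flow T X act g.
  by have [g <-] := generated_flow_surj (Gact t); exists g.
have subR t : exists g, reflection act t = @generated_flow T X act g.
  have [g <-] := generated_flow_surj (Gi _ _ (Gact t) (Kr t) (rK t)).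
  by exists g.
have stabX (K : set X) : (forall t, act t @` K = K) ->
    forall g, @generated_flow T X act g @` K = K.
  move=> aK g; apply: (@generated_group_stable T X X act id K hact) => //.
  exact: (set_valP g).
have stabXX (K : set (X * X)) : (forall t, diag (act t) @` K = K) ->
    forall g, diag (@generated_flow T X act g) @` K = K.
  move=> aK g.
  apply: (@generated_group_stable T (X * X)%type X act (@diag X) K hact) => //.
    by apply/funext => -[].
  exact: (set_valP g).
(* The orbit closure of a distal point is minimal, so by amenability each [act t] maps it onto
   itself, and the whole group preserves it. *)
have orbG y : distal_point act y ->
    closure (orbit (@generated_flow T X act) y) `<=` closure (orbit act y).
  move=> dy; have apy := distal_almost_periodic cX hX ma dy.
  apply: closure_orbit_sub; first exact: closed_closure.
  move=> g; rewrite -[closure _](stabX _ _ g).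
    by exists y => //; exact: closure_orbit_refl.
  by move=> t; exact: amenable_orbit_closure_surj amT cX hX sf apy.
have distal1 y :
    distal_point act y <-> distal_point (@generated_flow T X act) y.
  split; last exact: distal_point_sub.
  move=> dy z yz zy prox; apply: zy; apply/esym.
  have apy := distal_almost_periodic cX hX ma dy.
  have apz := almost_periodic_closure ma apy (orbG _ dy _ yz).
  have apyz := distal_diag_almost_periodic cX hX ma dy apz.
  apply: (proximal_diag_stable hX ma apyz) prox; apply: stabXX => t.
  apply: (amenable_orbit_closure_surj t amT _ _ (semiflow_diag sf) apyz).
    exact: compact_setT_prod.
  exact: hausdorff_prod.
have denseT y : distal_point (@generated_flow T X act) y ->
    dense (orbit (@generated_flow T X act) y) -> dense (orbit act y).
  move=> /distal1 dy dGy; apply: closure_dense => z.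
  exact/(orbG _ dy)/dense_closure.
split=> //.
  split=> -[y [dy ey]]; exists y.
    by split; [exact/distal1|exact: dense_orbit_sub ey].
  by split; [exact/distal1|exact: denseT].
split=> -[y [dy ey]]; exists y; last first.
  have dr : distal_point (reflection act) y by exact: distal_point_sub dy.
  split=> //; apply: closure_dense => z.
  (* It is enough that each [act t y], the preimage of [y] under the reflection of [t], lies in the
     orbit closure of the reflection. *)
  have : closure (orbit act y) z by exact/dense_closure/denseT.
  apply: closure_orbit_sub; first exact: closed_closure.
  move=> t; apply: (distal_preimage_closure (s := t) cX hX mr _ dr (Kr t y)).
  exact: can_inj (rK t).
split; last exact: dense_orbit_sub ey.
move=> z _ zy prox; apply: zy; apply/esym.
have apy := distal_almost_periodic cX hX mr dy.
have apz := almost_periodic_closure mr apy (dense_closure ey (x := z)).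
have apyz := distal_diag_almost_periodic cX hX mr dy apz.
apply: (proximal_diag_stable hX mr apyz) prox; apply: stabXX => t.
(* The reflection of [t] maps the orbit closure of [(y, z)] onto a set containing it, which gives
   stability under [act t]; it also maps it into itself, which gives the other inclusion. *)
apply/seteqP; split=> [_ [p Np <-]|p Np].
  have [q Nq <-] := distal_diag_orbit_surj t cX hX mr hrefl dy ey Np.
  rewrite (_ : diag (act t) _ = q) //.
  by case: q {Nq} => q1 q2; rewrite /diag /= !rK.
exists (diag (reflection act t) p); last first.
  by case: p {Np} => p1 p2; rewrite /diag /= !rK.
exact: closure_orbit_act t (diag_act_monoid mr) Np.
Qed.
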